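(* Let $X$ be a separable infinite dimensional Banach space over $\mathbb{C}$, let $N\in\mathcal{B}(X)$ be nilpotent, and let $\lambda\in\mathbb{C}$ with $|\lambda|=1$. Then $\lambda I+N$ lies in the operator norm closure of the set of mixing operators on $X$.
   Context: $\mathcal{B}(X)$ denotes the bounded linear operators on $X$; $I$ is the identity operator. An operator $T\in\mathcal{B}(X)$ is mixing if for each pair $U,V$ of nonempty open subsets of $X$ there is $M$ such that $T^n(U)\cap V\neq\emptyset$ for all $n>M$. *)

(* Defs.v *)
From HB Require Import structures.
From mathcomp Require Import all_boot all_order all_algebra.
From mathcomp Require Import all_classical all_reals all_analysis.
From mathcomp Require Export complex.

Set Implicit Arguments.
Unset Strict Implicit.
Unset Printing Implicit Defensive.

Import Order.TTheory GRing.Theory Num.Theory numFieldNormedType.Exports.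

Local Open Scope classical_set_scope.
Local Open Scope ring_scope.

Definition separable (X : topologicalType) : Prop :=
  exists2 A : set X, countable A & dense A.

Definition infinite_dimensional (K : fieldType) (X : lmodType K) : Prop :=
  ~ exists (n : nat) (v : 'I_n -> X),
      forall x : X, exists c : 'I_n -> K, x = \sum_(i < n) c i *: v i.

(* Membership of a linear map in B(X), in the form used by the library lemmas
   [linear_boundedP] and [linear_bounded_continuous]. *)
Definition bounded_operator (K : numFieldType) (X : normedModType K)
  (T : {linear X -> X}) : Prop := bounded_near T (nbhs (0 : X)).

Definition nilpotent_map (X : zmodType) (T : X -> X) : Prop :=
  exists k : nat, forall x : X, iter k T x = 0.

Definition mixing (X : topologicalType) (T : X -> X) : Prop :=
  forall U V : set X, open U -> open V -> U !=set0 -> V !=set0 ->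
  exists M : nat, forall n : nat, (M < n)%N ->
    ((iter n T @` U) `&` V) !=set0.

Definition mixing_operators (K : numFieldType) (X : normedModType K) :
    set {linear X -> X} :=
  [set T | bounded_operator T /\ mixing T].
Arguments mixing_operators {K} X.

(* The norm of a complex normed space takes its values in R[i] (as nonnegative
   reals), so [complex.Re] only transports it to R, where suprema exist.
   The supremum is meaningful for bounded operators. *)
Definition opnorm (R : realType) (X : normedModType R[i]) (T : X -> X) : R :=
  sup [set complex.Re `|T x| | x in [set x : X | `|x| <= 1]].

(* Closure in B(X), for the metric (S, T) |-> opnorm (T - S). *)
Definition opnorm_closure (R : realType) (X : normedModType R[i])
    (A : set {linear X -> X}) : set {linear X -> X} :=
  [set S | bounded_operator S /\
    forall e : R, 0 < e -> exists T : {linear X -> X},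
      [/\ A T, bounded_operator T & opnorm (T \- S) < e]].

(* Main.v *)
(* Perturb [N] to [S = N + K] with [K] of small norm, so that [S] maps some
   dense subspace [F] onto itself and is locally nilpotent on it; then
   [lam + S] is mixing.

   Perturbation.  Applying powers of [N] to a dense sequence and discarding
   linearly dependent terms gives independent vectors [f 0, f 1, ...] with dense
   span such that [N (f n)] lies in [F n := span (f 0, ..., f (n-1))].  Take
   [K x = sum_m phi_m(x) f_m], where [phi_m] is a bounded functional vanishing
   on [F (m+1)] (Hahn-Banach) and small enough for the series to converge in
   norm.  Then [S] maps [F (n+1)] into [F n], and a generic choice of
   [phi_m (f_(m+1))] makes the coefficient of [f n] in [S (f (n+1))] nonzero,
   whence [F n] is contained in [S (F (n+1))].

   Mixing.  Put [A = S / lam].  Each [u] in [F] is the term [z n] of a sequence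
   with [A (z 0) = 0] and [A (z (k+1)) = z k].  Sending the binomial polynomial
   [binom(s, k)] to [z k] conjugates [1 + A] with the translation
   [p(s) |-> p(s + 1)].  If [beta = binom(s, n)] and [r > n], the polynomials
   [a = beta(s) (1 - s/m)^r] tend to [beta] while their translates
   [a(s + m) = beta(s + m) (-s/m)^r] tend to [0]; symmetrically
   [b = beta(s - m) (s/m)^r] tends to [0] and [b(s + m)] to [beta]. *)
Require Import Defs.
From HB Require Import structures.
From mathcomp Require Import all_boot all_order all_algebra.
From mathcomp Require Import all_classical all_reals all_analysis.
From mathcomp Require Import zify ring lra.
Import Order.TTheory GRing.Theory Num.Theory numFieldNormedType.Exports.
Local Open Scope classical_set_scope.
Local Open Scope ring_scope.
Local Open Scope complex_scope.

Set Implicit Arguments.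
Unset Strict Implicit.
Unset Printing Implicit Defensive.

(** * Hahn-Banach theorem *)

(** Only positive real scalars occur, so [V] is used as a real space; the inequality for the inverse
    scalar turns the homogeneity bound into an equality. *)
Definition sublinear {R : realType} {V : lmodType R[i]} (q : V -> R) : Prop :=
  (forall x y, q (x + y) <= q x + q y) /\
  (forall (t : R) x, 0 < t -> q (t%:C *: x) <= t * q x).

Lemma sublinearZ {R : realType} {V : lmodType R[i]} {q : V -> R} :
  sublinear q -> forall (t : R) x, 0 < t -> q (t%:C *: x) = t * q x.
Proof.
move=> [_ qZ] t x t0; apply/eqP; rewrite eq_le qZ//=.
rewrite -ler_pdivlMl//; have ti0 : 0 < t^-1 by rewrite invr_gt0.
apply: le_trans (qZ _ (t%:C *: x) ti0).
rewrite scalerA -rmorphM /= mulVf ?gt_eqF//.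
by rewrite (_ : 1%:C = 1)// scale1r.
Qed.

Lemma sublinear0 {R : realType} {V : lmodType R[i]} {q : V -> R} :
  sublinear q -> q 0 = 0.
Proof.
move=> sq; have := sublinearZ sq (0 : V) (ltr0Sn R 1); rewrite scaler0; lra.
Qed.

Lemma sublinear_opp {R : realType} {V : lmodType R[i]} {q : V -> R} :
  sublinear q -> forall x, - q (- x) <= q x.
Proof.
by move=> sq x; have := sq.1 x (- x); rewrite subrr (sublinear0 sq); lra.
Qed.

(** The index [k] combines separately chosen near-minimizers, and [b] keeps each infimum meaningful.
    It serves for infima over a chain, over tilts and over a subspace. *)
Lemma sublinear_inf {R : realType} {V : lmodType R[i]} {I : Type} (D : set I)
    (f : I -> V -> R) (b : V -> R) :
  D !=set0 -> (forall i x, D i -> b x <= f i x) ->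
  (forall i j x y, D i -> D j -> exists2 k, D k & f k (x + y) <= f i x + f j y) ->
  (forall i (t : R) x, D i -> 0 < t ->
     exists2 k, D k & f k (t%:C *: x) <= t * f i x) ->
  sublinear (fun x => inf [set f i x | i in D]).
Proof.
move=> [i0 Di0] lb fD fZ.
have hlb x : has_lbound [set f i x | i in D].
  by exists (b x) => _ [i Di <-]; exact: lb.
have ne x : [set f i x | i in D] !=set0 by exists (f i0 x), i0.
have infle i x : D i -> inf [set f i x | i in D] <= f i x.
  by move=> Di; apply: ge_inf => //; exists i.
split=> [x y|t x t0].
- rewrite -lerBlDr; apply: lb_le_inf => // _ [i Di <-].
  rewrite lerBlDr -lerBlDl; apply: lb_le_inf => // _ [j Dj <-].
  rewrite lerBlDl; have [k Dk] := fD i j x y Di Dj.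
  by apply: le_trans; exact: infle.
- rewrite -ler_pdivrMl//; apply: lb_le_inf => // _ [i Di <-].
  rewrite ler_pdivrMl//; have [k Dk] := fZ i t x Di t0.
  by apply: le_trans; exact: infle.
Qed.

(** Zorn's lemma for the reversed pointwise order: a nonempty chain is bounded by its pointwise
    infimum, finite since every member is at least [- p (- x)]. *)
Lemma minimal_sublinear {R : realType} {V : lmodType R[i]} (p : V -> R) :
  sublinear p -> exists q : V -> R, [/\ sublinear q, forall x, q x <= p x &
    forall r : V -> R, sublinear r -> (forall x, r x <= q x) -> r = q].
Proof.
move=> sp; pose T := {q : V -> R | sublinear q /\ forall x, q x <= p x}.
pose le (q r : T) := `[< forall x, sval r x <= sval q x >].
have [||||t tmin] := @Zorn T le.
- by move=> t; apply/asboolP => x.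
- move=> r s t /asboolP rs /asboolP st; apply/asboolP => x.
  exact: le_trans (st x) (rs x).
- move=> [r hr] [s hs] /asboolP rs /asboolP sr; apply: eq_exist => /=.
  by apply/funext => x; apply/eqP; rewrite eq_le; apply/andP; split.
- move=> A Atot; have [A0|/set0P A0] := eqVneq A set0.
    by exists (exist _ p (conj sp (fun x => lexx _))) => s; rewrite A0.
  have lb i x : A i -> - p (- x) <= sval i x.
    move: i => [q [sq qp]] _ /=; apply: le_trans (sublinear_opp sq x).
    by rewrite lerN2.
  pose q x := inf [set sval i x | i in A].
  have sq : sublinear q.
    apply: sublinear_inf A0 lb _ _ => [i j x y Ai Aj|i t x Ai t0].
    - have [/asboolP ij|/asboolP ji] := Atot i j Ai Aj.
      + exists j => //; apply: le_trans (((svalP j).1).1 x y) _.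
        by rewrite lerD2r.
      + exists i => //; apply: le_trans (((svalP i).1).1 x y) _.
        by rewrite lerD2l.
    - by exists i => //; exact: ((svalP i).1).2.
  have qle s x : A s -> q x <= sval s x.
    move=> As; apply: ge_inf; last by exists s.
    by exists (- p (- x)) => _ [i Ai <-]; exact: lb.
  have [s0 As0] := A0.
  have qp x : q x <= p x by apply: le_trans (qle _ _ As0) ((svalP s0).2 x).
  exists (exist _ q (conj sq qp)) => s As; apply/asboolP => x /=.
  exact: qle.
exists (sval t); have [st tp] := svalP t; split=> // r sr rt.
have rp x : r x <= p x by apply: le_trans (rt x) (tp x).
by have <- := tmin (exist _ r (conj sr rp)) (asboolT rt).
Qed.

(* Makes [-y] extremal: any functional below this one takes the value [p y] at
   [y] as soon as it is additive. *)
Lemma sublinear_tilt {R : realType} {V : lmodType R[i]} (p : V -> R) (y : V) :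
  sublinear p -> exists q : V -> R,
    [/\ sublinear q, forall x, q x <= p x &
        forall x, q x <= p (x + y) - p y].
Proof.
move=> sp; pose f (t : R) x := p (x + t%:C *: y) - t * p y.
pose D := [set t : R | 0 <= t].
have pZ t : 0 <= t -> p (t%:C *: y) = t * p y.
  rewrite le_eqVlt => /predU1P[<-|]; last exact: sublinearZ.
  by rewrite scale0r mul0r sublinear0.
have lb t x : D t -> - p (- x) <= f t x.
  move=> t0; have := sp.1 (x + t%:C *: y) (- x).
  by rewrite addrAC subrr add0r pZ// /f; lra.
have le_f t x : D t -> inf [set f t x | t in D] <= f t x.
  move=> Dt; apply: ge_inf; last by exists t.
  by exists (- p (- x)) => _ [i Ai <-]; exact: lb.
exists (fun x => inf [set f t x | t in D]); split.
- apply: sublinear_inf lb _ _ => [|s t x z s0 t0|s t x s0 t0].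
  + by exists 0; rewrite /D /=.
  + exists (s + t); first exact: addr_ge0.
    have := sp.1 (x + s%:C *: y) (z + t%:C *: y).
    by rewrite addrACA -scalerDl -rmorphD /f/=; lra.
  + exists (t * s); first exact: mulr_ge0 (ltW t0) s0.
    have := sublinearZ sp (x + s%:C *: y) t0.
    by rewrite scalerDr scalerA -rmorphM /f /= => ->; rewrite mulrBr mulrA.
- move=> x; have := @le_f 0 x (lexx _).
  by rewrite /f scale0r addr0 mul0r subr0.
- move=> x; have := @le_f 1 x ler01.
  by rewrite /f (_ : 1%:C = 1)// scale1r mul1r.
Qed.

(** Minimality forces additivity: the tilt of [h] along [v] lies below [h], hence equals it.
    Minimizing below the tilt of [p] along [y] secures the value at [y]. *)
Lemma hahn_banach {R : realType} {V : lmodType R[i]} (p : V -> R) (y : V) :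
  sublinear p -> exists h : V -> R,
    [/\ forall u v, h (u + v) = h u + h v,
        forall (t : R) x, h (t%:C *: x) = t * h x,
        forall x, h x <= p x & h y = p y].
Proof.
move=> sp; have [p1 [sp1 p1p p1y]] := sublinear_tilt y sp.
have [h [sh hp1 hmin]] := minimal_sublinear sp1.
have hD u v : h (u + v) = h u + h v.
  apply/eqP; rewrite eq_le sh.1/=.
  have [g [sg gh gv]] := sublinear_tilt v sh.
  (* As [g = h], the last tilt inequality reads [h u <= h (u + v) - h v]. *)
  by rewrite -(hmin g sg gh) -lerBrDr [leRHS](_ : _ = h (u + v) - h v)
    ?(hmin g sg gh)// -{1}(hmin g sg gh); exact: gv.
have h0 := sublinear0 sh.
have hN x : h (- x) = - h x.
  by apply/eqP; rewrite -addr_eq0 -hD addNr h0.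
have hle x : h x <= p x by apply: le_trans (hp1 x) (p1p x).
exists h; split=> //.
- move=> t x; have [t0|t0|->] := ltgtP t 0.
  + rewrite -[t]opprK rmorphN scaleNr hN (sublinearZ sh) ?oppr_gt0//.
    by rewrite !mulNr.
  + exact: (sublinearZ sh).
  + by rewrite scale0r mul0r.
- apply/eqP; rewrite eq_le hle/=.
  (* At [- y] the tilt gives [h (- y) <= p 0 - p y]. *)
  have := le_trans (hp1 (- y)) (p1y (- y)).
  by rewrite addNr (sublinear0 sp) hN; lra.
Qed.

(** * The norm of a complex normed space as a real number *)

Definition rnorm {R : realType} {X : normedZmodType R[i]} (x : X) : R :=
  complex.Re `|x|.

Lemma rnormE {R : realType} {X : normedZmodType R[i]} (x : X) :
  `|x| = (rnorm x)%:C.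
Proof. by rewrite /rnorm RRe_real. Qed.

Lemma rnorm_ge0 {R : realType} {X : normedZmodType R[i]} (x : X) :
  0 <= rnorm x.
Proof. by rewrite -ler0c -rnormE. Qed.

Lemma rnorm0 {R : realType} {X : normedZmodType R[i]} : rnorm (0 : X) = 0.
Proof. by rewrite /rnorm normr0. Qed.

Lemma rnormN {R : realType} {X : normedZmodType R[i]} (x : X) :
  rnorm (- x) = rnorm x.
Proof. by rewrite /rnorm normrN. Qed.

Lemma ler_rnormD {R : realType} {X : normedZmodType R[i]} (x y : X) :
  rnorm (x + y) <= rnorm x + rnorm y.
Proof. by rewrite -lecR rmorphD/= -!rnormE ler_normD. Qed.

Lemma rnormZ {R : realType} {X : normedModType R[i]} (a : R[i]) (x : X) :
  rnorm (a *: x) = rnorm a * rnorm x.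
Proof. by apply: complexI; rewrite rmorphM/= -!rnormE normrZ. Qed.

Lemma rnorm_real {R : realType} (t : R) : rnorm (t%:C : R[i]) = `|t|.
Proof. by rewrite /rnorm normc_def/= expr0n addr0 sqrtr_sqr. Qed.

Lemma rnorm_le_normRe_Im {R : realType} (a b : R) :
  rnorm (a +i* b : R[i]) <= `|a| + `|b|.
Proof.
rewrite (complexE (a +i* b)); apply: le_trans (ler_rnormD _ _) _ => /=.
rewrite rnorm_real lerD2l /rnorm normrM; rewrite (rnormE b%:C) rnorm_real.
by rewrite (_ : `|'i| = 1) ?mul1r// normc_def/= expr0n expr1n add0r sqrtr1.
Qed.

Lemma rnorm_ltP {R : realType} {X : normedZmodType R[i]} (x : X) (e : R[i]) :
  0 < e -> (`|x| < e) = (rnorm x < complex.Re e).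
Proof. by move=> e0; rewrite rnormE -[e]RRe_real ?gtr0_real// ltcR. Qed.

Lemma Re_gt0 {R : realType} (e : R[i]) : 0 < e -> 0 < complex.Re e.
Proof. by move=> e0; rewrite -ltcR RRe_real// gtr0_real. Qed.

(** * Separation of a point from a closed subspace *)

Definition is_subspace {K : fieldType} {V : lmodType K} (F : set V) : Prop :=
  F 0 /\ forall a x y, F x -> F y -> F (a *: x + y).

Lemma subspaceD {K : fieldType} {V : lmodType K} (F : set V) x y :
  is_subspace F -> F x -> F y -> F (x + y).
Proof. by move=> sF Fx Fy; rewrite -[x]scale1r; exact: sF.2. Qed.

Lemma subspaceZ {K : fieldType} {V : lmodType K} (F : set V) a x :
  is_subspace F -> F x -> F (a *: x).
Proof. by move=> sF Fx; rewrite -[_ *: _]addr0; apply: sF.2 Fx sF.1. Qed.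

Lemma subspaceB {K : fieldType} {V : lmodType K} (F : set V) x y :
  is_subspace F -> F x -> F y -> F (x - y).
Proof.
by move=> sF Fx Fy; rewrite -scaleN1r; apply: subspaceD => //; exact: subspaceZ.
Qed.

Lemma subspace_sum {K : fieldType} {V : lmodType K} (F : set V) n
    (x : 'I_n -> V) :
  is_subspace F -> (forall i, F (x i)) -> F (\sum_(i < n) x i).
Proof.
by move=> sF Fx; elim/big_ind : _ => //; [exact: sF.1|move=> *; exact: subspaceD].
Qed.

Lemma sublinear_dist {R : realType} {X : normedModType R[i]} (F : set X) :
  is_subspace F -> sublinear (fun x => inf [set rnorm (x - y) | y in F]).
Proof.
move=> sF; apply: (@sublinear_inf _ _ _ F _ (fun=> 0)).
- by exists 0; exact: sF.1.
- by move=> *; exact: rnorm_ge0.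
- move=> y z u v Fy Fz; exists (y + z); first exact: subspaceD.
  by rewrite opprD addrACA ler_rnormD.
- move=> y t x Fy t0; exists (t%:C *: y); first exact: subspaceZ.
  by rewrite -scalerBr rnormZ rnorm_real gtr0_norm.
Qed.

Lemma dist_gt0 {R : realType} {X : normedModType R[i]} (F : set X) (v : X) :
  is_subspace F -> closed F -> ~ F v -> 0 < inf [set rnorm (v - y) | y in F].
Proof.
move=> sF cF nFv; have : nbhs v (~` F) by apply: open_nbhs_nbhs; split => //;
  exact: closed_openC.
move=> /nbhs_normP[e /= e0 eF].
apply: lt_le_trans (Re_gt0 e0) _; apply: lb_le_inf.
  by exists (rnorm (v - 0)); exists 0 => //; exact: sF.1.
move=> _ [y Fy <-]; rewrite leNgt; apply/negP.
by rewrite -rnorm_ltP// => /eF; exact.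
Qed.

(** A real functional dominated by the distance to [F] and attaining it at [v] vanishes on [F] and
    is positive at [v]; it is then complexified and normalized. *)
Lemma hahn_banach_separation {R : realType} {X : normedModType R[i]}
    (F : set X) (v : X) :
  is_subspace F -> closed F -> ~ F v ->
  exists g : X -> R[i], [/\ forall a x y, g (a *: x + y) = a * g x + g y,
    exists2 C : R, 0 < C & forall x, rnorm (g x) <= C * rnorm x,
    forall x, F x -> g x = 0 & g v = 1].
Proof.
move=> sF cF nFv; pose p x := inf [set rnorm (x - y) | y in F].
have [h [hD hZ hp hv]] := hahn_banach v (sublinear_dist sF).
have ple x y : F y -> p x <= rnorm (x - y).
  move=> Fy; apply: ge_inf; last by exists y.
  by exists 0 => _ [z _ <-]; exact: rnorm_ge0.
have h0 : h 0 = 0 by have := hZ 0 0; rewrite scale0r mul0r.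
have hN x : h (- x) = - h x by apply/eqP; rewrite -addr_eq0 -hD addNr h0.
have hle x y : F y -> `|h x| <= rnorm (x - y).
  move=> Fy; rewrite ler_norml lerNl -hN; apply/andP; split.
    apply: le_trans (hp _) _; rewrite -[leRHS]rnormN opprB addrC.
    rewrite -[y]opprK; apply: ple; rewrite -scaleN1r; exact: subspaceZ.
  by apply: le_trans (hp _) _; exact: ple.
(* The complex linear functional with real part [h]. *)
pose g x : R[i] := h x -i* h ('i *: x).
have gD x y : g (x + y) = g x + g y.
  by rewrite /g scalerDr !hD opprD.
have gZ a x : g (a *: x) = a * g x.
  case: a => a b; rewrite /g (complexE (a +i* b)) /=.
  rewrite scalerDl scalerDr !scalerA ['i * ('i * _)]mulrA -['i * 'i]expr2 sqr_i mulN1r.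
  rewrite [_ * b%:C]mulrC [_ * a%:C]mulrC -!scalerA scaleNr !hD !hN !hZ.
  simpc; rewrite /=; congr (_ +i* _); ring.
have gv0 : g v != 0.
  apply/eqP => -[] /eqP; rewrite hv => /eqP pv0 _.
  by have := dist_gt0 sF cF nFv; rewrite pv0 ltxx.
have rgv0 : 0 < rnorm (g v).
  by rewrite -ltcR -rnormE normr_gt0.
exists (fun x => g x / g v); split.
- by move=> a x y; rewrite gD gZ mulrDl mulrA.
(* The [2] comes from bounding the real and imaginary parts separately, each by [rnorm x]. *)
- exists (2 / rnorm (g v)); first by rewrite divr_gt0.
  move=> x; rewrite mulrAC; have -> : rnorm (g x / g v) = rnorm (g x) / rnorm (g v).
    by apply: complexI; rewrite rmorphM/= fmorphV/= -!rnormE normrM normfV.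
  rewrite ler_pM2r ?invr_gt0//; apply: le_trans (rnorm_le_normRe_Im _ _) _.
  have := hle x 0 sF.1; have := hle ('i *: x) 0 sF.1; rewrite !subr0 normrN.
  rewrite rnormZ {1}/rnorm normc_def/= expr0n expr1n add0r sqrtr1; lra.
- move=> x Fx; have hF y : F y -> h y = 0.
    move=> Fy; apply/eqP; rewrite -normr_le0; apply: le_trans (hle y y Fy) _.
    by rewrite subrr rnorm0.
  rewrite {1}/g (hF x)// (hF ('i *: x)); last exact: subspaceZ.
  by rewrite oppr0 mul0r.
- exact: divff.
Qed.

(** * Orbits of unipotent operators *)

Section NewtonSeries.
Variables (K : numFieldType) (V : lmodType K).

Definition fdiff (p : {poly K}) : {poly K} := p \Po ('X + 1%:P) - p.

Fact fdiff_is_linear : linear fdiff.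
Proof.
by move=> a p q; rewrite /fdiff linearP scalerBr opprD addrACA.
Qed.

HB.instance Definition _ :=
  GRing.isLinear.Build K {poly K} {poly K} _ fdiff fdiff_is_linear.

Lemma size_fdiff (p : {poly K}) : (size (fdiff p) <= (size p).-1)%N.
Proof.
elim/poly_ind: p => [|p c IH]; first by rewrite linear0 size_poly0.
have -> : fdiff (p * 'X + c%:P) = fdiff p * 'X + (p \Po ('X + 1%:P)).
  rewrite /fdiff comp_polyD comp_polyM comp_polyX comp_polyC polyC1; ring.
have [->|p0] := eqVneq p 0.
  by rewrite linear0 comp_poly0 mul0r addr0 size_poly0.
have -> : (size (p * 'X + c%:P)).-1 = size p.
  by rewrite size_MXaddC (negPf p0).
rewrite (leq_trans (size_polyD _ _))// geq_max size_comp_poly2 ?size_XaddC//.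
rewrite leqnn andbT (leq_trans (size_polyMleq _ _))// size_polyX addn2 /=.
by rewrite (leq_ltn_trans IH)// ltn_predL size_poly_gt0.
Qed.

Lemma size_iter_fdiff k (p : {poly K}) :
  (size (iter k fdiff p) <= size p - k)%N.
Proof.
elim: k => [|k IH] /=; first by rewrite subn0.
by rewrite (leq_trans (size_fdiff _))// subnS -!subn1 leq_sub2r.
Qed.

(* Newton's forward difference formula with [z k] in place of the binomial
   polynomial [binom(X, k)]. *)
Definition newton (z : nat -> V) (M : nat) (p : {poly K}) : V :=
  \sum_(k < M) (iter k fdiff p).[0] *: z k.

Fact newton_is_linear z M : linear (newton z M).
Proof.
move=> a p q; rewrite /newton scaler_sumr -big_split; apply: eq_bigr => k _ /=.
have -> : iter k fdiff (a *: p + q) = a *: iter k fdiff p + iter k fdiff q.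
  by elim: (nat_of_ord k) => //= j ->; rewrite linearP.
by rewrite hornerD hornerZ scalerDl scalerA.
Qed.

HB.instance Definition _ z M :=
  GRing.isLinear.Build K {poly K} V _ (newton z M) (newton_is_linear z M).

Fixpoint binomial_poly (k : nat) : {poly K} :=
  if k is k'.+1 then
    k%:R^-1 *: (binomial_poly k' * ('X - k'%:R%:P))
  else 1.

(** The absorption identity for binomial coefficients; Pascal's rule [fdiff_binomial] follows from
    it. *)
Lemma binomial_poly_shift k :
  binomial_poly k.+1 \Po ('X + 1%:P) =
  k.+1%:R^-1 *: (binomial_poly k * ('X + 1%:P)).
Proof.
elim: k => [|k IH].
  rewrite /= subr0 !mul1r linearZ/= comp_polyX //.
rewrite [binomial_poly k.+2]/= linearZ/= comp_polyM.
rewrite -/(binomial_poly k.+1) IH comp_polyB comp_polyX comp_polyC.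
rewrite (_ : 'X + 1%:P - k.+1%:R%:P = 'X - k%:R%:P); last first.
  by rewrite -[in LHS]natr1 polyCD; ring.
by rewrite [binomial_poly k.+1]/= -!scalerAl mulrAC.
Qed.

Lemma fdiff_binomial k : fdiff (binomial_poly k.+1) = binomial_poly k.
Proof.
rewrite /fdiff binomial_poly_shift /= -scalerBr -mulrBr opprB addrACA.
rewrite addrC addrA -addrA [X in _ * X](_ : _ = k.+1%:R%:P); last first.
  by rewrite -natr1 polyCD; ring.
by rewrite mulrC mul_polyC scalerA mulVf ?scale1r// pnatr_eq0.
Qed.

Lemma binomial_poly_at0 k : (binomial_poly k).[0] = (k == 0%N)%:R.
Proof.
elim: k => [|k IH] /=; first by rewrite hornerC.
rewrite hornerZ hornerM IH hornerXsubC sub0r; case: k {IH} => [|k] /=.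
  by rewrite oppr0 !mulr0.
by rewrite mul0r mulr0.
Qed.

(** The [k]-th difference of [binom(X, n)] is [binom(X, n - k)], which at [0] survives only for
    [k = n]; for [k > n] it is a difference of a constant. *)
Lemma newton_binomial z M n : (n < M)%N -> newton z M (binomial_poly n) = z n.
Proof.
move=> nM; have fd k j : iter k fdiff (binomial_poly (k + j)) = binomial_poly j.
  by elim: k => // k IH; rewrite iterSr addSn fdiff_binomial.
have fn : iter n fdiff (binomial_poly n) = 1.
  by have := fd n 0%N; rewrite addn0.
rewrite /newton (bigD1 (Ordinal nM))//= fn hornerC scale1r.
rewrite big1 ?addr0// => -[k kM]; rewrite -val_eqE/= => kn.
have [kn'|nk|/eqP] := ltngtP k n; last by rewrite (negPf kn).
  rewrite -(subnKC (ltnW kn')) fd binomial_poly_at0 subn_eq0 leqNgt kn'.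
  by rewrite scale0r.
rewrite -(subnK nk) iterD iterS fn (_ : fdiff 1 = 0); last first.
  by rewrite /fdiff -polyC1 comp_polyC subrr.
rewrite (_ : iter _ _ _ = 0) ?horner0 ?scale0r//.
by elim: (k - n.+1)%N => //= i ->; rewrite linear0.
Qed.

Lemma size_binomial_poly k : (size (binomial_poly k) <= k.+1)%N.
Proof.
elim: k => [|k IH] /=; first by rewrite size_poly1.
rewrite (leq_trans (size_scale_leq _ _))// (leq_trans (size_polyMleq _ _))//.
by rewrite size_XsubC addn2.
Qed.

(** [newton] intertwines [fdiff] with [A], since both move the index by one, and [1 + fdiff] is
    translation by [1]. The bound on [size p] kills the difference of order [M], where the truncated
    sums would disagree. *)
Lemma newton_shift (A : {linear V -> V}) z M (p : {poly K}) :
  A (z 0%N) = 0 -> (forall k, A (z k.+1) = z k) -> (size p <= M)%N ->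
  newton z M p + A (newton z M p) = newton z M (p \Po ('X + 1%:P)).
Proof.
move=> Az0 AzS pM; have -> : p \Po ('X + 1%:P) = p + fdiff p.
  by rewrite /fdiff [RHS]addrC subrK.
rewrite linearD /=; congr (_ + _); case: M pM => [|M] pM.
  by rewrite /= /newton !big_ord0 linear0.
rewrite {1}/newton big_ord_recl linearD linearZ/= Az0 scaler0 add0r.
rewrite /newton big_ord_recr /= -iterSr.
have -> : iter M.+1 fdiff p = 0.
  apply/eqP; rewrite -size_poly_leq0 (leq_trans (size_iter_fdiff _ _))//.
  by rewrite leqn0 subn_eq0.
rewrite horner0 scale0r addr0 linear_sum; apply: eq_bigr => k _.
by rewrite linearZ /= AzS -iterS iterSr.
Qed.

Lemma newton_shift_iter (A : {linear V -> V}) z M (p : {poly K}) m :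
  A (z 0%N) = 0 -> (forall k, A (z k.+1) = z k) -> (size p <= M)%N ->
  iter m (fun x => x + A x) (newton z M p) = newton z M (p \Po ('X + m%:R%:P)).
Proof.
move=> Az0 AzS pM; elim: m => [|m IH].
  by rewrite addr0 comp_polyXr.
rewrite iterS IH newton_shift//; last by rewrite size_comp_poly2 ?size_XaddC.
rewrite -comp_polyA comp_polyD comp_polyX comp_polyC -natr1 polyCD addrA.
by rewrite addrAC.
Qed.

End NewtonSeries.

Lemma cvg_invS {R : realType} :
  (m.+1%:R^-1 : (R[i] : numFieldType)) @[m --> \oo] --> (0 : (R[i] : numFieldType)).
Proof.
apply/cvgr0Pnorm_lt => e e0; have := @cvg_harmonic R.
move=> /cvgr0Pnorm_lt /(_ _ (Re_gt0 e0)); apply: filterS => m.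
rewrite rnorm_ltP//.
by rewrite [_^-1](_ : _ = (m.+1%:R^-1)%:C) ?rnorm_real// fmorphV/= rmorph_nat.
Qed.

(** Stands in for continuity of [Phi]: each induction step expands one factor, moving [e m] out as a
    scalar. The step multiplies [p] by ['X], hence the general [p]. *)
Lemma cvg_newton_linear {R : realType} {X : normedModType R[i]}
    (Phi : {linear {poly R[i]} -> X}) (e : nat -> R[i]) (c d : R[i]) j :
  (e : nat -> (R[i] : numFieldType)) @ \oo --> (0 : (R[i] : numFieldType)) -> forall p,
  Phi (p * (c%:P + (d * e m) *: 'X) ^+ j) @[m --> \oo] --> Phi (p * c%:P ^+ j).
Proof.
move=> e0; elim: j => [|j IH] p.
  by under eq_fun do rewrite expr0 mulr1; rewrite expr0 mulr1; exact: cvg_cst.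
have E m : Phi (p * (c%:P + (d * e m) *: 'X) ^+ j.+1) =
  c *: Phi (p * (c%:P + (d * e m) *: 'X) ^+ j) +
  (d * e m) *: Phi (p * 'X * (c%:P + (d * e m) *: 'X) ^+ j).
  rewrite -!linearZ -linearD /=; congr (Phi _); rewrite -!mul_polyC exprS; ring.
under eq_fun do rewrite E.
have -> : Phi (p * c%:P ^+ j.+1) =
    c *: Phi (p * c%:P ^+ j) + (d * 0) *: Phi (p * 'X * c%:P ^+ j).
  rewrite mulr0 scale0r addr0 -linearZ /=; congr (Phi _).
  rewrite -!mul_polyC exprS; ring.
apply: cvgD; first by apply: cvgZl_tmp; exact: IH.
apply: cvgZ; last exact: IH.
apply: (@cvgM _ _ _ _ (fun=> d) e); [exact: cvg_cst|exact: e0].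
Qed.

Lemma unipotent_orbits {R : realType} {X : normedModType R[i]}
    (A : {linear X -> X}) (z : nat -> X) (n : nat) :
  A (z 0%N) = 0 -> (forall k, A (z k.+1) = z k) ->
  exists a b : nat -> X,
    [/\ a @ \oo --> z n,
        iter m (fun x => x + A x) (a m) @[m --> \oo] --> (0 : X),
        b @ \oo --> (0 : X) &
        iter m (fun x => x + A x) (b m) @[m --> \oo] --> z n].
Proof.
move=> Az0 AzS; pose C : numFieldType := R[i]; pose N := n.+1.
pose e (m : nat) : C := m.+1%:R^-1.
have e0 : e @ \oo --> (0 : C) := cvg_invS.
pose beta : {poly C} := binomial_poly C n.
have sbeta : (size beta <= N)%N by exact: size_binomial_poly.
(* Large enough for a polynomial of size at most [N] times [N] affine factors. *)
pose M := (N + N + N)%N.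
pose Phi : {linear {poly C} -> X} := newton z M.
have Pb : Phi beta = z n.
  by rewrite /Phi /= newton_binomial// /M /N; rewrite -addnA ltn_addr.
(* The sequences will be [U (-1)] and [W 1]; translation by [m.+1] takes them to [W (-1)] and
   [U 1]. *)
pose U (s : C) m := beta * (1%:P + (s * e m) *: 'X) ^+ N.
pose W (s : C) m := (beta \Po ('X - (s * m.+1%:R)%:P)) * ((s * e m) *: 'X) ^+ N.
have cU s : Phi (U s m) @[m --> \oo] --> z n.
  by have := @cvg_newton_linear _ _ Phi e 1 s N e0 beta;
    rewrite expr1n mulr1 Pb; exact.
have cW s : Phi (W s m) @[m --> \oo] --> (0 : X).
  (* Expand [beta] in monomials: [j] of the [N] factors [e m] absorb the growth of the [j]-th power,
     and the remaining [e m ^+ (N - j)] tends to [0] because [j < N]. *)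
  have E m : Phi (W s m) = \sum_(j < size beta)
      (beta`_j * e m ^+ (N - j)) *:
        Phi (s ^+ N *: 'X^N * ((- s)%:P + (1 * e m) *: 'X) ^+ j).
    have em : e m * m.+1%:R = 1 by rewrite mulVf// pnatr_eq0.
    rewrite -[RHS]/(\sum_(j < size beta) _) /W comp_polyE mulr_suml linear_sum.
    apply: eq_bigr => j _ /=; rewrite -linearZ /=; congr (Phi _).
    have jN : (j <= N)%N by rewrite ltnW// (leq_trans (ltn_ord j)).
    have -> : (- s)%:P + (1 * e m) *: 'X = e m *: ('X - (s * m.+1%:R)%:P).
      rewrite scalerBr mul1r addrC polyCN; congr (_ - _).
      by rewrite -mul_polyC -polyCM mulrCA em mulr1.
    have eN : e m ^+ N = e m ^+ (N - j) * e m ^+ j by rewrite -exprD subnK.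
    rewrite !exprZn eN -!mul_polyC !polyCM; ring.
  under eq_fun do rewrite E.
  have -> : nbhs (0 : X) = nbhs (\sum_(j < size beta) (0 : X)) by rewrite big1.
  apply: cvg_big => [|j _]; first exact: add_continuous.
  rewrite -[0 : X](scale0r (Phi (s ^+ N *: 'X^N * (- s)%:P ^+ j))).
  apply: cvgZ; last exact: (@cvg_newton_linear _ _ Phi e (- s) 1 j e0).
  have jN : (j < N)%N by rewrite (leq_trans (ltn_ord j)).
  have cX k : (e m ^+ k) @[m --> \oo] --> (0 ^+ k : C).
    elim: k => [|k IH]; first by under eq_fun do rewrite expr0; exact: cvg_cst.
    by under eq_fun do rewrite exprS; rewrite exprS;
      exact: (@cvgM _ _ _ _ e _ 0 _ e0 IH).
  have cj := @cvgM _ _ _ _ (fun=> beta`_j : C) _ _ _ (cvg_cst _) (cX (N - j)%N).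
  have := cj _ _; rewrite expr0n subn_eq0 leqNgt jN mulr0; exact.
have em m : m.+1%:R * e m = 1 by rewrite mulfV// pnatr_eq0.
have iterPhi m (p : {poly C}) : (size p <= M)%N ->
    iter m (fun x => x + A x) (Phi p) = Phi (p \Po ('X + m%:R%:P)).
  exact: newton_shift_iter.
have slin (c d : C) : (size (c%:P + d *: 'X)%R <= 2)%N.
  rewrite (leq_trans (size_polyD _ _))// geq_max.
  rewrite (leq_trans (size_polyC_leq1 _))//=.
  by rewrite (leq_trans (size_scale_leq _ _))// size_polyX.
have sexp (p q : {poly C}) : 
    (size p <= N)%N -> (size q <= 2)%N -> (size (p * q ^+ N)%R <= M)%N.
  move=> sp sq; rewrite (leq_trans (size_polyMleq _ _))//.
  have : (size (q ^+ N)%R <= N.+1)%N.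
    rewrite (leq_trans (size_poly_exp_leq _ _))// ltnS.
    by rewrite -{2}[N]mul1n leq_mul2r -subn1 leq_subLR sq orbT.
  rewrite /M; lia.
have sU s m : (size (U s m) <= M)%N by exact: sexp.
have sW s m : (size (W s m) <= M)%N.
  apply: sexp; first by rewrite size_comp_poly2 ?size_XsubC.
  by have := slin 0 (s * e m); rewrite add0r.
have eP m : e m *: (m.+1%:R%:P : {poly C}) = 1%:P.
  by rewrite -mul_polyC -polyCM mulrC em.
have compU m : U (-1) m \Po ('X + m.+1%:R%:P) = W (-1) m.
  rewrite /U /W comp_polyM rmorphXn /= comp_polyD comp_polyC.
  rewrite comp_polyZ comp_polyX !mulN1r polyCN opprK; congr (_ * _ ^+ N).
  by rewrite scalerDr !scaleNr eP addrCA subrr addr0.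
have compW m : W 1 m \Po ('X + m.+1%:R%:P) = U 1 m.
  rewrite /U /W comp_polyM rmorphXn /= -comp_polyA comp_polyB comp_polyC.
  rewrite comp_polyZ !comp_polyX !mul1r addrK comp_polyXr; congr (_ * _ ^+ N).
  by rewrite scalerDr addrC eP.
(* The predecessor pairs time [m.+1] with the polynomial of index [m]; the term at [0] does not
   affect the limits. *)
exists (fun m => Phi (U (-1) m.-1)), (fun m => Phi (W 1 m.-1)); split.
- by rewrite -(cvg_shiftS (fun m => Phi (U (-1) m.-1))); exact: cU.
- rewrite -cvg_shiftS; under eq_fun do rewrite iterPhi// compU.
  exact: cW.
- by rewrite -(cvg_shiftS (fun m => Phi (W 1 m.-1))); exact: cW.
- rewrite -cvg_shiftS; under eq_fun do rewrite iterPhi// compW.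
  exact: cU.
Qed.

(** * Mixing from local nilpotency and surjectivity on a dense set *)

Lemma nilpotent_chain {K : fieldType} {V : lmodType K} (A : {linear V -> V})
    (F : set V) (u : V) (n : nat) :
  (forall x, F x -> exists2 y, F y & A y = x) -> F u -> iter n A u = 0 ->
  exists z : nat -> V, [/\ A (z 0%N) = 0, forall k, A (z k.+1) = z k & z n = u].
Proof.
move=> Asurj Fu Anu.
have /choice[g gP] x : exists y, F x -> F y /\ A y = x.
  have [Fx|nFx] := pselect (F x); last by exists 0.
  by have [y Fy <-] := Asurj x Fx; exists y.
have Fg k : F (iter k g u) by elim: k => //= k /gP[].
(* Below [n] the chain consists of images of [u]; above [n] it is continued by a right inverse of
   [A] on [F]. *)
exists (fun k => if (k <= n)%N then iter (n - k) A u else iter (k - n) g u).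
split; last by rewrite leqnn subnn.
- by rewrite leq0n subn0 Anu linear0.
- move=> k; have [kn|nk|->] := ltngtP k n.
  + by rewrite -iterS -subSn// subSS.
  + by rewrite subSn 1?ltnW//= (gP _ (Fg _)).2.
  + by rewrite subSnn subnn /= (gP _ Fu).2.
Qed.

Lemma cvg_scale_norm1 {R : realType} {X : normedModType R[i]}
    (c : nat -> R[i]) (b : nat -> X) :
  (forall m, `|c m| = 1) -> b @ \oo --> (0 : X) ->
  c m *: b m @[m --> \oo] --> (0 : X).
Proof.
move=> c1 /cvgr0Pnorm_lt b0; apply/cvgr0Pnorm_lt => e /b0.
by apply: filterS => m; rewrite normrZ c1 mul1r.
Qed.

Lemma mixing_unipotent {R : realType} {X : normedModType R[i]}
    (A : {linear X -> X}) (lam : R[i]) (F : set X) :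
  `|lam| = 1 -> dense F ->
  (forall x, F x -> exists n, iter n A x = 0) ->
  (forall x, F x -> exists2 y, F y & A y = x) ->
  mixing (fun x => lam *: (x + A x)).
Proof.
move=> lam1 dF Anil Asurj U V oU oV U0 V0.
have [u [Uu Fu]] := dF U U0 oU; have [v [Vv Fv]] := dF V V0 oV.
have [nu Anu] := Anil u Fu; have [nv Anv] := Anil v Fv.
have [zu [Azu0 AzuS zuE]] := nilpotent_chain Asurj Fu Anu.
have [zv [Azv0 AzvS zvE]] := nilpotent_chain Asurj Fv Anv.
have [a [_ [au Ba _ _]]] := unipotent_orbits nu Azu0 AzuS.
have [_ [b [_ _ b0 Bb]]] := unipotent_orbits nv Azv0 AzvS.
have lam0 : lam != 0 by rewrite -normr_eq0 lam1 oner_eq0.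
have lamX m : `|lam ^+ m| = 1 by rewrite normrX lam1 expr1n.
(* This starts near [u] because [b m] is small. At time [m] the [a] part has died out and the [b]
   part is near [v], its weight cancelling [lam ^+ m]. *)
pose w m := a m + (lam ^+ m)^-1 *: b m.
have wu : w @ \oo --> u.
  rewrite -[u]addr0 -zuE; apply: cvgD => //; apply: cvg_scale_norm1 => // m.
  by rewrite normfV lamX invr1.
have TwE m : iter m (fun x => lam *: (x + A x)) (w m) =
    lam ^+ m *: iter m (fun x => x + A x) (a m) +
    iter m (fun x => x + A x) (b m).
  have TE k x : iter k (fun x => lam *: (x + A x)) x =
      lam ^+ k *: iter k (fun x => x + A x) x.
    elim: k => [|k IH] /=; first by rewrite scale1r.
    by rewrite IH linearZ/= -scalerDr scalerA -exprS.
  have BD k c x y : iter k (fun x => x + A x) (x + c *: y) =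
      iter k (fun x => x + A x) x + c *: iter k (fun x => x + A x) y.
    elim: k => //= k ->; rewrite linearD linearZ /= scalerDr.
    by rewrite addrACA.
  rewrite TE BD scalerDr scalerA mulfV ?scale1r// expf_neq0//.
have Twv : iter m (fun x => lam *: (x + A x)) (w m) @[m --> \oo] --> v.
  under eq_fun do rewrite TwE.
  rewrite -[v]add0r -zvE; apply: cvgD => //; exact: cvg_scale_norm1.
have nU : nbhs u U by exact: open_nbhs_nbhs.
have nV : nbhs v V by exact: open_nbhs_nbhs.
have [M _ HM] : \forall m \near \oo, U (w m) /\
    V (iter m (fun x => lam *: (x + A x)) (w m)).
  by apply: filterI; [exact: wu|exact: Twv].
exists M => m /ltnW /HM[Uw Vw].
by exists (iter m (fun x => lam *: (x + A x)) (w m)); split => //; exists (w m).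
Qed.

(** * Invariant flags *)

Lemma bounded_operatorP {R : realType} {X : normedModType R[i]}
    (T : {linear X -> X}) :
  bounded_operator T <-> exists C : R, forall x, rnorm (T x) <= C * rnorm x.
Proof.
rewrite /bounded_operator; split.
  move=> /linear_boundedP/pinfty_ex_gt0[M M0 TM]; exists (complex.Re M) => x.
  by rewrite -lecR rmorphM/= -!rnormE RRe_real ?gtr0_real.
move=> [C TC]; apply/linear_boundedP; exists C%:C; split.
  by apply/complex_realP; exists C.
move=> r rC x; apply: (@le_trans _ _ (C%:C * `|x|)).
  by rewrite !rnormE -rmorphM lecR.
by rewrite ler_wpM2r// ltW.
Qed.

Definition adjoin {K : fieldType} {V : lmodType K} (F : set V) (v : V) : set V :=
  [set x | exists c, F (x - c *: v)].

Lemma sub_adjoin {K : fieldType} {V : lmodType K} (F : set V) v :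
  F `<=` adjoin F v.
Proof. by move=> x Fx; exists 0; rewrite scale0r subr0. Qed.

Lemma mem_adjoin {K : fieldType} {V : lmodType K} (F : set V) v :
  is_subspace F -> adjoin F v v.
Proof. by move=> sF; exists 1; rewrite scale1r subrr; exact: sF.1. Qed.

Lemma subspace_adjoin {K : fieldType} {V : lmodType K} (F : set V) v :
  is_subspace F -> is_subspace (adjoin F v).
Proof.
move=> sF; split; first exact: sub_adjoin sF.1.
move=> a x y [c Fx] [d Fy]; exists (a * c + d).
by rewrite scalerDl opprD addrACA -scalerA -scalerBr; exact: sF.2.
Qed.

(** For [v] outside [F], a separating functional [g] gives the bounded map [x - g x *: v], under
    which the extended subspace is the preimage of [F]. *)
Lemma closed_adjoin {R : realType} {X : normedModType R[i]} (F : set X) v :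
  is_subspace F -> closed F -> closed (adjoin F v).
Proof.
move=> sF cF; have [Fv|nFv] := pselect (F v).
  suff -> : adjoin F v = F by [].
  apply/seteqP; split; last exact: sub_adjoin.
  by move=> x [c Fx]; rewrite -[x](subrK (c *: v)); apply: subspaceD => //;
    exact: subspaceZ.
have [g [glin [C C0 gC] gF gv]] := hahn_banach_separation sF cF nFv.
have -> : adjoin F v = (fun x => x - g x *: v) @^-1` F.
  apply/seteqP; split=> x /=; last by exists (g x).
  move=> [c Fx]; suff -> : g x = c by [].
  have -> : x = c *: v + (x - c *: v) by rewrite addrC subrK.
  by rewrite glin gv mulr1 (gF _ Fx) addr0.
have lin_h : linear (fun x => x - g x *: v).
  move=> a x y; rewrite glin scalerDl -scalerA opprD addrACA.
  by rewrite scalerBr.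
pose h : {linear X -> X} := HB.pack (fun x => x - g x *: v)
  (GRing.isLinear.Build _ _ _ _ (fun x => x - g x *: v) lin_h).
apply: (preimage_closed (f := h)) => // x _.
apply: bounded_linear_continuous; apply/bounded_operatorP.
exists (1 + C * rnorm v) => z; rewrite mulrDl mul1r /=.
apply: le_trans (ler_rnormD _ _) _; rewrite rnormN rnormZ lerD2l mulrAC.
by rewrite ler_wpM2r// rnorm_ge0.
Qed.

Lemma dense_closed {T : topologicalType} (A F : set T) :
  dense A -> closed F -> A `<=` F -> F = setT.
Proof.
move=> dA cF AF; apply/seteqP; split=> // x _; apply: contrapT => nFx.
have [y [nFy Ay]] := dA (~` F) (ex_intro _ x nFx) (closed_openC cF).
exact: nFy (AF y Ay).
Qed.

Lemma countable_dense_seq {X : topologicalType} (x0 : X) :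
  separable X -> exists x : nat -> X, dense (range x).
Proof.
(* Integers coding no point of [A] are sent to [x0], which is harmless for density. *)
move=> [A /countable_injP[f finj] dA].
exists (fun j => xget x0 [set a | A a /\ f a = j]).
move=> O O0 oO; have [a [Oa Aa]] := dA O O0 oO; exists a; split=> //.
exists (f a) => //; case: xgetP => [b _ [Ab fb]|/(_ a)]; last by case.
by apply: finj; rewrite ?inE.
Qed.

(** [F n] is the span of [f 0, ..., f (n-1)], and [flag_new] expresses independence. Closedness is
    recorded for Hahn-Banach separation. *)
Record flag {R : realType} {X : normedModType R[i]} (f : nat -> X)
    (F : nat -> set X) : Prop := Flag {
  flag0 : F 0%N = [set 0];
  flagS : forall n, F n.+1 = adjoin (F n) (f n);
  flag_closed : forall n, closed (F n);
  flag_new : forall n, ~ F n (f n);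
  flag_dense : dense (\bigcup_n F n) }.

Lemma flag_subspace {R : realType} {X : normedModType R[i]} (f : nat -> X)
    (F : nat -> set X) : flag f F -> forall n, is_subspace (F n).
Proof.
move=> fF; elim=> [|n IH].
  rewrite (flag0 fF); split=> // a x y /= -> ->.
  by rewrite scaler0 addr0.
by rewrite (flagS fF); exact: subspace_adjoin.
Qed.

Lemma flag_le {R : realType} {X : normedModType R[i]} (f : nat -> X)
    (F : nat -> set X) m n : flag f F -> (m <= n)%N -> F m `<=` F n.
Proof.
move=> fF mn; rewrite -(subnKC mn); elim: (n - m)%N => [|k IH].
  by rewrite addn0.
by rewrite addnS (flagS fF) => x /IH; exact: sub_adjoin.
Qed.

(** Greedy selection: adjoin the first [y j] not yet spanned. If none were left, a closed, finitely
    spanned subspace would contain a dense set, hence be all of [X]. Minimality of [j] later yields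
    invariance under [N]. *)
Lemma exists_flag {R : realType} {X : normedModType R[i]} (y : nat -> X) :
  dense (range y) -> infinite_dimensional X ->
  exists f F, flag f F /\
    forall n, exists2 j, f n = y j & forall i, (i < j)%N -> F n (y i).
Proof.
move=> dy infX.
have /choice[g gP] (F : set X) : exists j, (exists i, ~ F (y i)) ->
    ~ F (y j) /\ forall i, (i < j)%N -> F (y i).
  have [[j nFj]|nex] := pselect (exists i, ~ F (y i)); last by exists 0%N.
  have exj : exists j, ~~ `[< F (y j) >] by exists j; apply/asboolPn.
  exists (ex_minn exj) => _; case: ex_minnP => i /asboolPn nFi imin.
  split=> // k ki; apply: contrapT => /asboolPn /imin.
  by rewrite leqNgt ki.
pose F n := iter n (fun F => adjoin F (y (g F))) [set 0].
pose f n := y (g (F n)).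
have FS n : F n.+1 = adjoin (F n) (f n) by [].
have sF n : is_subspace (F n).
  elim: n => [|n IH]; last by rewrite FS; exact: subspace_adjoin.
  by split=> // a x z /= -> ->; rewrite scaler0 addr0.
have cF n : closed (F n).
  elim: n => [|n IH]; last by rewrite FS; exact: closed_adjoin.
  exact/accessible_closed_set1/hausdorff_accessible/norm_hausdorff.
have span_F n x : F n x -> exists c : nat -> R[i], x = \sum_(i < n) c i *: f i.
  elim: n x => [|n IH] x; first by move=> ->; exists (fun=> 0); rewrite big_ord0.
  move=> [c /IH[d xd]]; exists (fun i => if i == n then c else d i).
  rewrite big_ord_recr /= eqxx -[LHS](subrK (c *: f n)) xd; congr (_ + _).
  by apply: eq_bigr => i _; rewrite ltn_eqF.
have exF n : exists i, ~ F n (y i).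
  apply: contrapT => nex; apply: infX; exists n, (fun i => f i) => x.
  have FT : F n = setT.
    apply: dense_closed dy (cF n) _ => _ [i _ <-].
    by apply: contrapT => nFi; apply: nex; exists i.
  by have [|c ->] := span_F n x; [rewrite FT|exists (fun i => c i)].
(* At stage [n] the term [y n] is either already spanned or the one selected, since the selected
   index cannot be below [n]. *)
have yF n i : (i < n)%N -> F n (y i).
  elim: n i => // n IH i; rewrite ltnS leq_eqVlt FS => /predU1P[->|/IH]; last first.
    exact: sub_adjoin.
  have [ng|gn|ng] := ltngtP n (g (F n)).
  - by apply: sub_adjoin; exact: (gP _ (exF n)).2.
  - by case: (gP _ (exF n)).1; exact: IH.
  - by have -> : y n = f n; [rewrite /f -ng|exact: mem_adjoin].
exists f, F; split; last first.
  by move=> n; exists (g (F n)) => //; exact: (gP _ (exF n)).2.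
split=> // [n|]; first exact: (gP _ (exF n)).1.
move=> O O0 oO; have [x [Ox [i _ yi]]] := dy O O0 oO.
by exists x; split=> //; rewrite -yi; exists i.+1 => //; exact: yF.
Qed.

Lemma exists_invariant_flag {R : realType} {X : normedModType R[i]}
    (N : {linear X -> X}) :
  separable X -> infinite_dimensional X -> nilpotent_map N ->
  exists f F, flag f F /\ forall n, F n (N (f n)).
Proof.
move=> sepX infX [k Nk]; have [x dx] := countable_dense_seq (0 : X) sepX.
(* Blocks [N^k x_q, ..., N x_q, x_q] of length [k.+1]: [N] sends the first term of a block to [0]
   and every other one to its predecessor. *)
pose y j := iter (k - j %% k.+1)%N N (x (j %/ k.+1)%N).
have dy : dense (range y).
  move=> O O0 oO; have [z [Oz [i _ xi]]] := dx O O0 oO.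
  exists z; split=> //; exists (i * k.+1 + k)%N => //.
  by rewrite /y modnMDl divnMDl// modn_small// divn_small// subnn addn0.
have Ny j : N (y j) = 0 \/ exists2 i, (i < j)%N & N (y j) = y i.
  rewrite /y; set q := (j %/ _)%N; have jE := divn_eq j k.+1.
  have := ltn_pmod j (ltn0Sn k); rewrite ltnS; move: jE.
  case: (j %% k.+1)%N => [|r] jE rk.
    by left; rewrite subn0 -iterS iterSr Nk.
  right; exists (q * k.+1 + r)%N; first by rewrite jE addnS.
  rewrite modnMDl divnMDl// modn_small 1?ltnW// divn_small 1?ltnW// addn0.
  by rewrite -iterS -subSn// subSS.
have [f [F [fF fy]]] := exists_flag dy infX; exists f, F; split=> // n.
have [j -> yF] := fy n; have [->|[i ij ->]] := Ny j; last exact: yF.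
exact: (flag_subspace fF n).1.
Qed.

(** * The perturbation *)

Lemma dyadic_series {R : realType} {X : completeNormedModType R[i]}
    (u : nat -> X) (M : R) :
  (forall m, rnorm (u m) <= M / 2 ^+ m.+1) ->
  cvgn (series u) /\ rnorm (limn (series u)) <= M.
Proof.
move=> uM; have M0 : 0 <= M.
  by have := le_trans (rnorm_ge0 _) (uM 0%N); rewrite pmulr_lge0 ?invr_gt0.
(* The bound on [u k] equals [M / 2 ^+ k - M / 2 ^+ k.+1], so blocks telescope. *)
have bnd n d : rnorm (\sum_(n <= k < n + d) u k) <= M / 2 ^+ n - M / 2 ^+ (n + d).
  elim: d => [|d IH]; first by rewrite addn0 subrr big_geq// rnorm0.
  rewrite addnS big_nat_recr ?leq_addr//=.
  apply: le_trans (ler_rnormD _ _) _; apply: le_trans (lerD IH (uM _)) _.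
  rewrite exprS invfM; set t := (2 ^+ (n + d))^-1; lra.
have bnd' n m : rnorm (\sum_(n <= k < m) u k) <= M / 2 ^+ n.
  have [mn|nm] := leqP m n.
    by rewrite big_geq// rnorm0 divr_ge0// exprn_ge0.
  rewrite -(subnKC (ltnW nm)); apply: le_trans (bnd _ _) _.
  by rewrite gerBl divr_ge0// exprn_ge0.
have cu : cvgn (series u).
  apply/cauchy_cvgP/cauchy_seriesP => e e0.
  have : (geometric M (2^-1 : R)) @ \oo --> (0 : R).
    by apply: cvg_geometric; rewrite ger0_norm ?invr_ge0//; lra.
  move=> /cvgr0Pnorm_lt /(_ _ (Re_gt0 e0)) [n0 _ Hn].
  exists ([set n | (n0 <= n)%N], [set n | (n0 <= n)%N]) => /=.
    by split; exists n0.
  move=> [n m] /= [n0n _]; rewrite rnorm_ltP//; apply: le_lt_trans (bnd' _ _) _.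
  have := Hn n n0n; rewrite /geometric /= exprVn ger0_norm//.
  by rewrite divr_ge0// exprn_ge0.
(* A limit of norm above [M] would force partial sums of norm above [M], against [bnd'] from [0]. *)
split=> //; rewrite leNgt; apply/negP => lt_M.
have := @cvgr_norm_gt _ _ _ _ _ _ _ cu M%:C.
rewrite rnormE ltcR => /(_ _ lt_M) [n _ /(_ n (leqnn n))] /=.
rewrite rnormE ltcR ltNge /series /= (le_trans (bnd' _ _))//.
by rewrite expr0 divr1.
Qed.

(** A small positive multiple of a functional separating [f m.+1] from [F m.+1]. The multiplier is
    its value at [f m.+1], so one of [w] and [w / 2] avoids [b]. *)
Lemma flag_functional {R : realType} {X : normedModType R[i]} (f : nat -> X)
    (F : nat -> set X) (m : nat) (d : R) (b : R[i]) :
  flag f F -> 0 < d ->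
  exists phi : X -> R[i], [/\ forall a x y, phi (a *: x + y) = a * phi x + phi y,
    forall x, rnorm (phi x *: f m) <= d * rnorm x,
    forall x, F m.+1 x -> phi x = 0 & phi (f m.+1) != b].
Proof.
move=> fF d0; have [g [glin [C C0 gC] gF gf]] :=
  hahn_banach_separation (flag_subspace fF m.+1) (flag_closed fF (n := m.+1))
    (flag_new fF (n := m.+1)).
pose w := d / (C * (1 + rnorm (f m))).
have fm0 := rnorm_ge0 (f m).
have w0 : 0 < w by rewrite divr_gt0 ?mulr_gt0//; lra.
have [v [v0 vw vb]] : exists v : R, [/\ 0 < v, v <= w & v%:C != b].
  have [wb|wb] := eqVneq w%:C b; last by exists w.
  exists (w / 2); split; [lra|lra|]; rewrite -wb.
  by apply/eqP => /complexI; lra.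
exists (fun x => v%:C * g x); split.
- by move=> a x y; rewrite glin; ring.
- move=> x; rewrite -scalerA !rnormZ rnorm_real gtr0_norm//.
  apply: (@le_trans _ _ (w * (C * rnorm x * (1 + rnorm (f m))))).
    rewrite ler_pM ?(ltW v0)// ?mulr_ge0 ?rnorm_ge0//.
    by rewrite ler_pM ?rnorm_ge0 ?gC//; lra.
  rewrite le_eqVlt; apply/orP; left; apply/eqP; rewrite /w.
  by field; apply/andP; split; lra.
- by move=> x /gF ->; rewrite mulr0.
- by rewrite gf mulr1.
Qed.

Lemma small_flag_operator {R : realType} {X : completeNormedModType R[i]}
    (f : nat -> X) (F : nat -> set X) (b : nat -> R[i]) (d : R) :
  flag f F -> 0 < d ->
  exists K : {linear X -> X}, [/\ forall x, rnorm (K x) <= d * rnorm x,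
    forall n x, F n.+1 x -> F n (K x) &
    forall n, exists2 c, c != b n & F n (K (f n.+1) - c *: f n)].
Proof.
move=> fF d0; have dm m : 0 < d / 2 ^+ m.+1 by rewrite divr_gt0// exprn_gt0.
have /choice[phi phiP] m := flag_functional m (b m) fF (dm m).
pose u x m := phi m x *: f m.
have uB x m : rnorm (u x m) <= d * rnorm x / 2 ^+ m.+1.
  by have [_ + _ _] := phiP m => /(_ x); rewrite mulrAC.
pose k x := limn (series (u x)).
have cu x : series (u x) @ \oo --> k x := (dyadic_series (uB x)).1.
have klin : linear k.
  move=> a x y; apply: cvg_lim; first exact: norm_hausdorff.
  rewrite [X in X @ _ --> _](_ : _ = (fun n => a *: series (u x) n + series (u y) n)).
    apply: cvgD (cu y); exact: cvgZl_tmp (cu x).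
  apply/funext => n; rewrite /series /= scaler_sumr -big_split /=.
  apply: eq_bigr => i _; have [plin _ _ _] := phiP i.
  by rewrite /u plin scalerDl scalerA.
pose K : {linear X -> X} := HB.pack k (GRing.isLinear.Build _ _ _ _ k klin).
(* The series terminates: [phi i] vanishes on [F i.+1], which contains [F n.+1] once [n <= i]. *)
have kF n x : F n.+1 x -> k x = \sum_(i < n) u x i.
  move=> Fx; rewrite /k -(big_mkord xpredT); apply: lim_near_cst.
    exact: norm_hausdorff.
  exists n => // m /= nm; rewrite /series /= (big_cat_nat (leq0n n) nm) /=.
  suff -> : \sum_(n <= i < m) u x i = 0 by rewrite addr0.
  rewrite big_nat big1// => i /andP[ni _].
  have [_ _ p0 _] := phiP i; rewrite /u p0 ?scale0r//.
  exact: (flag_le (m := n.+1) (n := i.+1) fF ni Fx).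
have fFlt i n : (i < n)%N -> F n (f i).
  move=> lin; apply: (flag_le fF lin); rewrite (flagS fF).
  exact: mem_adjoin (flag_subspace fF i).
exists K; split=> /=.
- by move=> x; exact: (dyadic_series (uB x)).2.
- move=> n x Fx; rewrite (kF n)//; apply: subspace_sum (flag_subspace fF n) _.
  by move=> i; apply: subspaceZ (flag_subspace fF n) (fFlt _ _ (ltn_ord i)).
- move=> n; exists (phi n (f n.+1)); first by have [_ _ _] := phiP n.
  (* The last surviving term is [phi n (f n.+1) *: f n]; the earlier ones lie in [F n]. *)
  rewrite (kF n.+1); last exact: fFlt.
  rewrite big_ord_recr /= addrK; apply: subspace_sum (flag_subspace fF n) _.
  by move=> i; apply: subspaceZ (flag_subspace fF n) (fFlt _ _ (ltn_ord i)).
Qed.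

(** * Operators lowering a flag *)

Lemma flag_nilpotent {R : realType} {X : normedModType R[i]} (f : nat -> X)
    (F : nat -> set X) (S : {linear X -> X}) :
  flag f F -> (forall n x, F n.+1 x -> F n (S x)) ->
  forall n x, F n x -> iter n S x = 0.
Proof.
move=> fF SF; elim=> [|n IH] x Fx; first by move: Fx; rewrite (flag0 fF).
by rewrite iterSr IH//; exact: SF.
Qed.

Lemma flag_descend {R : realType} {X : normedModType R[i]} (f : nat -> X)
    (F : nat -> set X) (N : {linear X -> X}) :
  flag f F -> (forall n, F n (N (f n))) -> forall n x, F n.+1 x -> F n (N x).
Proof.
move=> fF Nf; have sF := flag_subspace fF.
have step n : (forall x, F n x -> F n (N x)) -> forall x, F n.+1 x -> F n (N x).
  move=> IH x; rewrite (flagS fF) => -[c Fx].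
  have -> : N x = N (x - c *: f n) + c *: N (f n).
    by rewrite -linearZ -linearD subrK.
  by apply: subspaceD; [exact: sF|exact: IH|apply: subspaceZ].
elim=> [|n IH]; apply: step => x Fx.
  by move: Fx; rewrite (flag0 fF) => /= ->; rewrite linear0.
by apply: (flag_le fF (leqnSn n)); exact: IH.
Qed.

(** Since [c != 0], a multiple of [S (f n.+1)] matches the [f n] component of [x]; the rest lies in
    [F n] and has a preimage by induction. *)
Lemma flag_surjective {R : realType} {X : normedModType R[i]} (f : nat -> X)
    (F : nat -> set X) (S : {linear X -> X}) :
  flag f F ->
  (forall n, exists2 c, c != 0 & F n (S (f n.+1) - c *: f n)) ->
  forall n x, F n x -> exists2 y, F n.+1 y & S y = x.
Proof.
move=> fF Sf; have sF := flag_subspace fF.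
elim=> [|n IH] x.
  rewrite (flag0 fF) => /= ->; exists 0; last exact: linear0.
  exact: (sF _).1.
rewrite (flagS fF) => -[a Fx]; have [c c0 Fr] := Sf n.
have [y Fy Sy] : exists2 y, F n.+1 y & S y = x - (a / c) *: S (f n.+1).
  apply: IH; have -> : x - (a / c) *: S (f n.+1) =
      x - a *: f n - (a / c) *: (S (f n.+1) - c *: f n).
    by rewrite [in RHS]scalerBr scalerA divfK// opprB addrA subrK.
  by apply: subspaceB => //; exact: subspaceZ.
exists (y + (a / c) *: f n.+1); last by rewrite linearD linearZ /= Sy subrK.
apply: subspaceD; [exact: sF|exact: (flag_le fF (leqnSn _))|apply: subspaceZ => //].
by rewrite (flagS fF n.+1); exact: mem_adjoin.
Qed.

(** * Operator norm estimate and conclusion *)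

Lemma opnorm_le {R : realType} {X : normedModType R[i]} (T : X -> X) (d : R) :
  0 <= d -> (forall x, rnorm (T x) <= d * rnorm x) -> opnorm T <= d.
Proof.
move=> d0 Td; apply: ge_sup.
  by exists (complex.Re `|T 0|), 0 => //=; rewrite normr0.
move=> _ [x /= x1 <-]; apply: le_trans (Td x) _.
rewrite -[leRHS]mulr1 ler_wpM2l//.
by rewrite -lecR -rnormE.
Qed.

Unset Implicit Arguments.

Theorem corollary3p2 (R : realType) (X : completeNormedModType R[i])
  (sepX : separable X) (infX : infinite_dimensional X)
  (N : {linear X -> X}) (bN : bounded_operator N) (nilN : nilpotent_map N)
  (lam : R[i]) (lam1 : `|lam| = 1) :
  opnorm_closure (mixing_operators X)
    (((lam \*: (idfun : X -> X)) \+ N) : {linear X -> X}).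
Proof.
have [CN NC] := (bounded_operatorP N).1 bN.
have lam0 : lam != 0 by rewrite -normr_eq0 lam1 oner_eq0.
have rlam : rnorm lam = 1 by rewrite /rnorm lam1.
have bS0 : bounded_operator (((lam \*: (idfun : X -> X)) \+ N) : {linear X -> X}).
  apply/bounded_operatorP; exists (1 + CN) => x /=.
  apply: le_trans (ler_rnormD _ _) _.
  by rewrite rnormZ rlam mulrDl lerD2l.
split=> // e e0; have [f [F [fF Nf]]] := exists_invariant_flag sepX infX nilN.
have sF := flag_subspace fF.
have /choice[al alP] n : exists a, F n (N (f n.+1) - a *: f n).
  by have := Nf n.+1; rewrite (flagS fF).
have e2 : 0 < e / 2 by lra.
(* Avoiding [- al n] keeps the total coefficient [al n + c] of [f n] in [S (f n.+1)] nonzero;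
   [e / 2] leaves room for the strict inequality. *)
have [K [Ke KF Kf]] := small_flag_operator (fun n => - al n) fF e2.
pose S : {linear X -> X} := (N \+ K : X -> X).
pose T : {linear X -> X} := (((lam \*: (idfun : X -> X)) \+ N) \+ K : X -> X).
pose A : {linear X -> X} := (lam^-1 \*: S : X -> X).
have SF n x : F n.+1 x -> F n (S x).
  by move=> Fx; apply: subspaceD (sF n) _ (KF n x Fx); exact: (flag_descend fF).
have bT : bounded_operator T.
  have [CT TC] := (bounded_operatorP _).1 bS0.
  apply/bounded_operatorP; exists (CT + e / 2) => x /=.
  apply: le_trans (ler_rnormD _ _) _.
  by rewrite mulrDl lerD// TC.
exists T; split=> //.
- split=> //; have -> : (T : X -> X) = (fun x => lam *: (x + A x)).
    apply/funext => x; rewrite /T /A /= scalerDr scalerA mulfV// scale1r.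
    by rewrite addrA.
  apply: (mixing_unipotent lam1 (flag_dense fF)).
  + move=> x [n _ Fx]; exists n; apply: (flag_nilpotent fF) Fx => m y Fy.
    by apply: subspaceZ (sF m) _; exact: SF.
  + move=> x [n _ Fx].
    have Sf m : exists2 c, c != 0 & F m (S (f m.+1) - c *: f m).
      have [c cb Fc] := Kf m; exists (al m + c).
        by rewrite addrC -[al m]opprK subr_eq0.
      by rewrite scalerDl opprD addrACA; exact: subspaceD.
    (* The factor [lam] undoes the division in [A = S / lam]. *)
    have [y Fy Sy] := flag_surjective fF Sf Fx; exists (lam *: y).
      by exists n.+1 => //; exact: subspaceZ.
    by rewrite /A /= [N _ + K _](_ : _ = lam *: S y) ?scalerA ?mulVf ?scale1r//
       !linearZ -scalerDr.
- apply: (@le_lt_trans _ _ (e / 2)); last lra.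
  apply: opnorm_le => [|x]; first exact: ltW.
  by rewrite /T /= [_ + K x]addrC addrK.
Qed.
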